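(* Let $X$ be a (real or complex) Banach space of dimension not less than $3$. Let $T:\underline{X}\to\underline{X}$ and $S:\underline{X}'\to\underline{X}'$ be bijective transformations with the property that $$T\underline{x}\cdot S\underline{f}=0 \quad\text{if and only if}\quad \underline{x}\cdot\underline{f}=0$$ for every $\underline{x}\in\underline{X}$ and $\underline{f}\in\underline{X}'$. Consider the forms $$T\underline{x}=\underline{Ax}\quad\text{and}\quad S\underline{f}=\underline{(A^{-1})'f}\qquad (0\neq x\in X,\ 0\neq f\in X'). \quad ( * )$$ (1) If $X$ is real, then there exists an invertible bounded linear operator $A:X\to X$ such that $T,S$ are of the forms $( * )$. (2) If $X$ is complex and infinite dimensional, then there exists an invertible bounded linear or conjugate-linear operator $A:X\to X$ such that $T,S$ are of the forms $( * )$. (3) If $X$ is complex and finite dimensional, then there exist a ring automorphism $h$ of $\mathbb{C}$ and an invertible $h$-semilinear operator $A:X\to X$ such that $T,S$ are of the forms $( * )$. The operator $A$ above is unique up to multiplication by a scalar.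
   Context: Let $X$ be a Banach space over $\mathbb{K}\in\{\mathbb{R},\mathbb{C}\}$. $X'$ denotes the dual space of $X$ (all bounded linear functionals on $X$), and $\langle x,f\rangle$ denotes $f(x)$ for $x\in X$, $f\in X'$. For a vector $x$ in $X$, the set $\underline{x}$ of all nonzero scalar multiples of $x$ is called the ray generated by $x$; $\underline{X}$ denotes the set of all rays in $X$. Likewise $\underline{f}$ denotes the ray generated by $f\in X'$, and $\underline{X}'$ denotes the set of all rays in $X'$. Rays $\underline{x}\in\underline{X}$ and $\underline{f}\in\underline{X}'$ are orthogonal, written $\underline{x}\cdot\underline{f}=0$, if $\langle y,g\rangle=0$ for all $y\in\underline{x}$ and $g\in\underline{f}$. If $h$ is a ring automorphism of $\mathbb{K}$, a map $A:X\to X$ is called $h$-semilinear if it is additive and $A(\lambda x)=h(\lambda)Ax$ for every $x\in X$, $\lambda\in\mathbb{K}$. Adjoints: for a bounded linear operator $A$ on $X$, $A':X'\to X'$ is the Banach space adjoint, $A'f=f\circ A$. For a bounded conjugate-linear operator $A$ on a complex Banach space $X$, $A':X'\to X'$ is defined by $A'f=\overline{f\circ A}$. For an $h$-semilinear operator $A$ on a finite dimensional complex linear space $X$, $A':X'\to X'$ is defined by $A'f=h^{-1}\circ f\circ A$. (If $A$ is $h$-semilinear and invertible, then $A^{-1}$ is $h^{-1}$-semilinear, so that $(A^{-1})'f=h\circ f\circ A^{-1}$.) *)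

(* Defs.v *)
(* Complex scalars are R[i] (real-closed) for a realType R. *)
From HB Require Import structures.
From mathcomp Require Import all_boot all_order all_algebra.
From mathcomp Require Import all_classical all_reals all_analysis.
From mathcomp Require Import complex.

Set Implicit Arguments.
Unset Strict Implicit.
Unset Printing Implicit Defensive.

Import Order.TTheory GRing.Theory Num.Theory.
Import numFieldNormedType.Exports.

Local Open Scope classical_set_scope.
Local Open Scope ring_scope.

Section Dimension.
Variables (K : fieldType) (V : lmodType K).

Definition lin_indep (n : nat) (v : 'I_n -> V) : Prop :=
  forall a : 'I_n -> K, \sum_i a i *: v i = 0 -> forall i, a i = 0.

Definition dim_ge (n : nat) : Prop := exists v : 'I_n -> V, lin_indep v.

Definition finite_dim : Prop :=
  exists (n : nat) (v : 'I_n -> V),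
    forall x, exists a : 'I_n -> K, x = \sum_i a i *: v i.

End Dimension.

Section Rays.
Variables (K : fieldType) (V : lmodType K).

Definition ray_set (x : V) : set V := [set c *: x | c in [set c : K | c != 0]].

(* The generator is arbitrary, so the trivial ray [set 0] is included. *)
Record ray := Ray {
  set_of_ray : set V;
  rayP : exists x, set_of_ray = ray_set x }.

Definition ray_of (x : V) : ray := Ray (ex_intro _ x erefl).

End Rays.

Section Operators.
Variables (K : numFieldType).

Definition bounded_op (V W : normedModType K) (A : V -> W) : Prop :=
  exists M : K, forall x, `|A x| <= M * `|x|.

Definition is_semilinear (V : lmodType K) (h : K -> K) (A : V -> V) : Prop :=
  (forall x y, A (x + y) = A x + A y) /\
  (forall (l : K) x, A (l *: x) = h l *: A x).

Definition bounded_invertible (V : normedModType K) (A : V -> V) : Prop :=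
  exists B : V -> V, [/\ cancel A B, cancel B A, bounded_op A & bounded_op B].

End Operators.

Section Dual.
Variables (K : numFieldType) (X : normedModType K).

Definition bounded_functional : {pred X -> K^o} :=
  fun f => `[< linear f /\ bounded_op f >].

Lemma bounded_functional_submod : submod_closed bounded_functional.
Proof.
split.
  apply/asboolP; split; first by move=> a x y; rewrite /= scaler0 addr0.
  by exists 0 => x; rewrite mul0r normr0.
move=> a f g /asboolP[lf [M Mf]] /asboolP[lg [N Ng]]; apply/asboolP; split.
  move=> b x y /=; rewrite !fctE lf lg !scalerDr !scalerA mulrC -!addrA.
  by congr (_ + _); rewrite addrCA.
exists (`|a| * M + N) => x; rewrite !fctE mulrDl.
apply: (le_trans (ler_normD _ _)); apply: lerD; last exact: Ng.
by rewrite normrZ -mulrA ler_wpM2l.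
Qed.

HB.instance Definition _ :=
  GRing.isSubmodClosed.Build K (X -> K^o) bounded_functional
    (GRing.submod_closed_semi bounded_functional_submod).

Record dual := Dual {
  dual_fun :> X -> K^o;
  dualP : dual_fun \in bounded_functional }.

HB.instance Definition _ := [isSub for dual_fun].
HB.instance Definition _ := [Choice of dual by <:].
HB.instance Definition _ := [SubChoice_isSubLmodule of dual by <:].

Definition ray_orth (r : ray X) (s : ray dual) : Prop :=
  forall (y : X) (g : dual), set_of_ray r y -> set_of_ray s g -> g y = 0.

Definition preserves_orth (T : ray X -> ray X) (S : ray dual -> ray dual) :
    Prop :=
  forall (r : ray X) (s : ray dual), ray_orth (T r) (S s) <-> ray_orth r s.

(* [A'] is the adjoint of the [h]-semilinear operator [A], where [hinv] is the
   inverse of [h]; [hinv] is the identity for linear [A] and the conjugation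
   for conjugate-linear [A]. Since [A'] has values in [dual], boundedness of
   the functionals [hinv \o f \o A] is part of the assertion. *)
Definition is_adjoint (hinv : K -> K) (A : X -> X) (A' : dual -> dual) : Prop :=
  forall (f : dual) (x : X), A' f x = hinv (f (A x)).

(* For [h]-semilinear [A], the inverse [Ainv] is [h^-1]-semilinear, so its
   adjoint [B] is [f |-> h \o f \o Ainv]. *)
Definition induced_by (T : ray X -> ray X) (S : ray dual -> ray dual)
    (h : K -> K) (A : X -> X) : Prop :=
  exists (Ainv : X -> X) (B : dual -> dual),
    [/\ cancel A Ainv, cancel Ainv A, is_adjoint h Ainv B,
        (forall x : X, x != 0 -> T (ray_of x) = ray_of (A x)) &
        (forall f : dual, f != 0 -> S (ray_of f) = ray_of (B f))].

End Dual.

Definition exists_unique_up_to_scalar (K : fieldType) (V : lmodType K)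
    (P : (V -> V) -> Prop) : Prop :=
  (exists A, P A) /\
  (forall A B, P A -> P B -> exists2 c : K, c != 0 & forall x, B x = c *: A x).

(* Main.v *)
Require Import Defs.
From HB Require Import structures.
From mathcomp Require Import all_boot all_order all_algebra.
From mathcomp Require Import all_classical all_reals all_analysis.
From mathcomp Require Import complex.
From mathcomp Require Import ring.
Import Order.TTheory GRing.Theory Num.Theory.
Import numFieldNormedType.Exports.
Local Open Scope ring_scope.

(* By Hahn-Banach, a vector [z] lies in the span of [x] and [y] iff every bounded
   functional killing [x] and [y] kills [z]; hence [T] preserves lines of the
   projective space and the fundamental theorem of projective geometry gives an
   [h]-semilinear bijection [A] inducing it.  As [S f] and [h \o f \o A^-1] have
   the same kernel they are proportional, so [h \o f \o A^-1] is bounded for every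
   [f]; symmetrically [h^-1 \o f \o A] is bounded.  The only automorphism of the
   reals is the identity.  In the complex infinite-dimensional case a gliding hump
   along a triangular system of vectors and functionals shows that [h] is bounded
   near [0], hence is the identity or the conjugation.  In both cases [h] preserves
   the modulus and the uniform boundedness argument makes [A] and [A^-1] bounded. *)

Set Implicit Arguments.
Unset Strict Implicit.
Unset Printing Implicit Defensive.

(** * The fundamental theorem of projective geometry *)

(** Collinearity of projective points. Degenerate pairs are allowed, so [x = y] expresses
    proportionality. *)
Definition in_span2 (K : fieldType) (V : lmodType K) (x y z : V) : Prop :=
  exists a b : K, z = a *: x + b *: y.

Section Span2.
Variables (K : fieldType) (V : lmodType K).
Implicit Types x y z : V.

Lemma in_span2_diag x y : in_span2 x x y <-> exists a : K, y = a *: x.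
Proof.
split=> [[a [b ->]]|[a ->]]; first by exists (a + b); rewrite scalerDl.
by exists a, 0; rewrite scale0r addr0.
Qed.

Lemma comb3_eq (a b c a' b' c' : K) (u v w : V) :
  a *: u + b *: v + c *: w = a' *: u + b' *: v + c' *: w ->
  (b - b') *: v + (c - c') *: w = (a' - a) *: u.
Proof.
move=> E; rewrite !scalerBl addrACA -opprD; apply/eqP.
by rewrite subr_eq addrAC eq_sym subr_eq addrA -E [eqbRHS]addrC addrA.
Qed.

(** Otherwise the coordinates of three independent vectors form a 3 by 2 matrix, whose nonzero left
    kernel is a linear relation. *)
Lemma dim_ge3_span2 : dim_ge V 3 -> forall x y, exists z, ~ in_span2 x y z.
Proof.
move=> [v vindep] x y; apply: contrapT => /forallNP noz.
have /choice[c cP] : forall i, exists c : K * K, v i = c.1 *: x + c.2 *: y.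
  by move=> i; have /contrapT[a [b vi]] := noz (v i); exists (a, b).
pose M : 'M[K]_(3, 2) := \matrix_(i, j) (if j == 0 then (c i).1 else (c i).2).
have : kermx M != 0.
  rewrite kermx_eq0 -row_leq_rank -ltnNge.
  exact: leq_ltn_trans (rank_leq_col M) _.
move=> /rowV0Pn[u /sub_kermxP uM /eqP]; apply.
apply/rowP => i; rewrite mxE; apply: vindep.
have sumM j : \sum_i u 0 i * M i j = 0.
  by move/rowP: uM => /(_ j); rewrite !mxE.
under eq_bigr do rewrite cP scalerDr !scalerA.
rewrite big_split /= -!scaler_suml.
have := sumM 0; under eq_bigr do rewrite mxE /=; move=> ->.
have := sumM 1; under eq_bigr do rewrite mxE /=; move=> ->.
by rewrite !scale0r addr0.
Qed.

End Span2.

Section FundamentalTheorem.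
Variables (K : fieldType) (V W : lmodType K) (phi : V -> W).
Hypothesis phi_eq0 : forall x, phi x = 0 <-> x = 0.
Hypothesis phi_span : forall x y z,
  in_span2 (phi x) (phi y) (phi z) <-> in_span2 x y z.
Hypothesis phi_surj : forall y, exists x c, y = c *: phi x.
Hypothesis span2_proper : forall x y : V, exists z, ~ in_span2 x y z.
(** These fix an affine chart: [l = 0] is the hyperplane at infinity and the points [e + w] with
    [l w = 0] are the finite ones. *)
Variables (l : {scalar V}) (e : V).
Hypothesis le1 : l e = 1.

Let e' := phi e.

Lemma phi_line x y : (exists a, phi y = a *: phi x) <-> (exists a, y = a *: x).
Proof. by rewrite -!in_span2_diag. Qed.

Lemma phi_indep x y a b : x != 0 -> ~ (exists c, y = c *: x) ->
  a *: phi x + b *: phi y = 0 -> a = 0 /\ b = 0.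
Proof.
move=> x0 yx abE; have b0 : b = 0.
  have [//|b0] := eqVneq b 0; case: yx; apply/phi_line; exists (- (b^-1 * a)).
  rewrite scaleNr -scalerA -scalerN; move/eqP: abE; rewrite addr_eq0 => /eqP ->.
  by rewrite opprK scalerA mulVf ?scale1r.
split=> //; move: abE; rewrite b0 scale0r addr0 => /eqP.
by rewrite scaler_eq0 => /orP[/eqP//|/eqP/phi_eq0 xE]; rewrite xE eqxx in x0.
Qed.

(** If [c] were nonzero, [e] would lie in the span of [x] and [y], where [l] vanishes. *)
Lemma phi_ker x y a b c : l x = 0 -> l y = 0 ->
  a *: phi x + b *: phi y = c *: e' -> c = 0.
Proof.
move=> lx ly abE; have [//|c0] := eqVneq c 0.
have /phi_span[r [s eE]] : in_span2 (phi x) (phi y) (phi e).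
  exists (c^-1 * a), (c^-1 * b).
  by rewrite -!scalerA -scalerDr abE scalerA mulVf ?scale1r.
have := congr1 l eE; rewrite le1 linearD !linearZ /= lx ly !mulr0 addr0.
by move/eqP; rewrite oner_eq0.
Qed.

Lemma phi_affine w : exists b, l w = 0 ->
  (exists2 c, c != 0 & b = c *: phi w) /\
  (exists2 a, a != 0 & phi (e + w) = a *: (e' + b)).
Proof.
have [lw|] := pselect (l w = 0); last by exists 0.
have [w0|w0] := eqVneq w 0.
  exists 0 => _; have p0 : phi 0 = 0 by apply/phi_eq0.
  by rewrite w0 !addr0 p0; split; exists 1; rewrite ?oner_neq0 ?scaler0 ?scale1r.
have [a [b abE]] : in_span2 (phi e) (phi w) (phi (e + w)).
  by apply/phi_span; exists 1, 1; rewrite !scale1r.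
have a0 : a != 0.
  apply/eqP => aE; have /phi_line[c] : exists c, phi (e + w) = c *: phi w.
    by exists b; rewrite abE aE scale0r add0r.
  move/(congr1 l); rewrite linearD linearZ /= lw le1 mulr0 addr0 => /eqP.
  by rewrite oner_eq0.
have b0 : b != 0.
  apply/eqP => bE; have /phi_line[c ewE] : exists c, phi (e + w) = c *: phi e.
    by exists a; rewrite abE bE scale0r addr0.
  have := congr1 l ewE; rewrite linearD linearZ /= lw le1 mulr1 addr0 => cE.
  by move/eqP: w0; apply; apply: (addrI e); rewrite ewE -cE scale1r addr0.
exists (a^-1 * b *: phi w) => _; split.
  by exists (a^-1 * b); rewrite ?mulf_neq0 ?invr_eq0.
by exists a; rewrite // scalerDr scalerA mulrA divff // mul1r.
Qed.

(* For [w] in the hyperplane [l = 0], [aff w] is the point of the line of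
   [phi w] for which [phi (e + w)] is proportional to [phi e + aff w]. *)
Let aff : V -> W := projT1 (choice phi_affine).

Lemma aff_line w : l w = 0 -> exists2 c, c != 0 & aff w = c *: phi w.
Proof. by move=> lw; have [] := projT2 (choice phi_affine) w lw. Qed.

Lemma aff_spec w : l w = 0 ->
  exists2 a, a != 0 & phi (e + w) = a *: (e' + aff w).
Proof. by move=> lw; have [] := projT2 (choice phi_affine) w lw. Qed.

Lemma aff0 : aff 0 = 0.
Proof.
have [|c _ ->] := @aff_line 0; first by rewrite linear0.
by have -> : phi 0 = 0 by [apply/phi_eq0]; rewrite scaler0.
Qed.

Lemma aff_eq0 w : l w = 0 -> aff w = 0 -> w = 0.
Proof.
move=> /aff_line[c c0 ->] /eqP; rewrite scaler_eq0 (negbTE c0) /=.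
by move=> /eqP/phi_eq0.
Qed.

Lemma aff_ker x a c : l x = 0 -> a *: aff x = c *: e' -> c = 0.
Proof.
move=> lx; have [k _ ->] := aff_line lx; rewrite scalerA => aE.
by apply: (@phi_ker x x (a * k) 0 c) => //; rewrite scale0r addr0.
Qed.

(* [e + x + y] lies on the lines through [e + x], [y] and through [e + y], [x]. *)
Lemma aff_add_indep x y : l x = 0 -> l y = 0 -> x != 0 ->
  ~ (exists c, y = c *: x) -> aff (x + y) = aff x + aff y.
Proof.
move=> lx ly x0 yx; have lxy : l (x + y) = 0 by rewrite linearD lx ly addr0.
have [cx cx0 Bx] := aff_line lx; have [cy cy0 By] := aff_line ly.
have [ax ax0 Px] := aff_spec lx; have [ay ay0 Py] := aff_spec ly.
have [a [b E1]] : in_span2 (phi (e + x)) (phi y) (phi (e + (x + y))).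
  by apply/phi_span; exists 1, 1; rewrite !scale1r addrA.
have [a' [b' E2]] : in_span2 (phi (e + y)) (phi x) (phi (e + (x + y))).
  by apply/phi_span; exists 1, 1; rewrite !scale1r addrAC addrA.
(* Compare [E1] with [E2]: [phi_ker] matches the coefficients of [e'], then independence matches the
   others. *)
have [b'E bE aE] : [/\ b' = a * ax * cx, b = a' * ay * cy & a' * ay = a * ax].
  have E : (a * ax * cx - b') *: phi x + (b - a' * ay * cy) *: phi y =
      (a' * ay - a * ax) *: e'.
    apply: comb3_eq; transitivity (phi (e + (x + y))).
      by rewrite E1 Px Bx !scalerDr !scalerA !mulrA.
    by rewrite E2 Py By !scalerDr !scalerA !mulrA addrAC.
  have aE := phi_ker lx ly E; rewrite aE scale0r in E.
  have [b'E bE] := phi_indep x0 yx E.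
  by split; first apply/esym; apply/subr0_eq.
have E3 : phi (e + (x + y)) = (a * ax) *: (e' + (aff x + aff y)).
  rewrite E1 Px bE aE -scalerA -By scalerA -scalerDr; congr (_ *: _).
  by rewrite addrA.
(* [Pxy] and [E3] both express [phi (e + (x + y))]. As [aff (x + y)] lies in the span of [phi x] and
   [phi y], [phi_ker] equates the two outer factors, which then cancel. *)
have [c c0 Bxy] := aff_line lxy; have [axy axy0 Pxy] := aff_spec lxy.
have [r [s rsE]] : in_span2 (phi x) (phi y) (phi (x + y)).
  by apply/phi_span; exists 1, 1; rewrite !scale1r.
have E4 : axy *: aff (x + y) - (a * ax) *: (aff x + aff y) = (a * ax - axy) *: e'.
  apply/eqP; rewrite scalerBl subr_eq [eqbRHS]addrAC eq_sym subr_eq.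
  by rewrite -!scalerDr -E3 Pxy [e' + _]addrC.
have aE' : a * ax - axy = 0.
  apply: (@phi_ker x y (axy * c * r - a * ax * cx) (axy * c * s - a * ax * cy)) => //.
  by rewrite -E4 Bxy rsE Bx By !scalerBl !scalerDr !scalerA opprD addrACA.
move: E4; rewrite aE' scale0r; move/eqP: aE'; rewrite subr_eq0 => /eqP ->.
by move/eqP; rewrite -scalerBr scaler_eq0 (negbTE axy0) subr_eq0 => /eqP.
Qed.
Lemma ker_proper (x : V) : l x = 0 -> exists2 z, l z = 0 & ~ exists c, z = c *: x.
Proof.
move=> lx; have [z zex] := span2_proper e x.
exists (z - l z *: e); first by rewrite linearB linearZ /= le1 mulr1 subrr.
move=> [c zE]; apply: zex; exists (l z), c.
by rewrite -zE addrC subrK.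
Qed.

Lemma ker_neq0 (x z : V) : ~ (exists c : K, z = c *: x) -> z != 0.
Proof. by move=> zx; apply/eqP => z0; apply: zx; exists 0; rewrite scale0r. Qed.

Lemma aff_scale_line x t : exists k, l x = 0 -> aff (t *: x) = k *: aff x.
Proof.
have [lx|] := pselect (l x = 0); last by exists 0.
have [|c _ ->] := @aff_line (t *: x); first by rewrite linearZ /= lx mulr0.
have [k k0 ->] := aff_line lx.
have /phi_line[a ->] : exists a, t *: x = a *: x by exists t.
by exists (c * a / k) => _; rewrite !scalerA divfK.
Qed.

Let ratio (x : V) : K -> K := projT1 (choice (aff_scale_line x)).

Lemma ratioP x t : l x = 0 -> aff (t *: x) = ratio x t *: aff x.
Proof. exact: projT2 (choice (aff_scale_line x)) t. Qed.

(** Expand [aff (t *: (x + y))] in two ways and compare coefficients: both ratios equal that of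
    [x + y]. *)
Lemma ratio_indep x y t : l x = 0 -> l y = 0 -> x != 0 ->
  ~ (exists c, y = c *: x) -> ratio x t = ratio y t.
Proof.
move=> lx ly x0 yx; have lxy : l (x + y) = 0 by rewrite linearD lx ly addr0.
have E : aff (t *: (x + y)) = aff (t *: x) + aff (t *: y).
  have [->|t0] := eqVneq t 0; first by rewrite !scale0r aff0 addr0.
  rewrite scalerDr; apply: aff_add_indep; rewrite ?linearZ /= ?lx ?ly ?mulr0 //.
    by rewrite scaler_eq0 negb_or t0.
  move=> [c yE]; apply: yx; exists c; apply: (scalerI t0).
  by rewrite yE !scalerA mulrC.
have {E} : (ratio (x + y) t - ratio x t) *: aff x +
    (ratio (x + y) t - ratio y t) *: aff y = 0.
  rewrite !scalerBl addrACA -scalerDr -aff_add_indep // -ratioP // E !ratioP //.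
  by rewrite -opprD subrr.
have [cx cx0 ->] := aff_line lx; have [cy cy0 ->] := aff_line ly.
rewrite !scalerA => /(phi_indep x0 yx)[/eqP + /eqP].
rewrite !mulf_eq0 (negbTE cx0) (negbTE cy0) !orbF !subr_eq0.
by move=> /eqP <- /eqP <-.
Qed.

Lemma ratio_const x y t : l x = 0 -> l y = 0 -> x != 0 -> y != 0 -> ratio x t = ratio y t.
Proof.
move=> lx ly x0 y0.
have [[c yE]|yx] := pselect (exists c, y = c *: x); last exact: ratio_indep.
(* Proportional vectors are compared through a third one independent of both. *)
have [z lz zx] := ker_proper lx; rewrite (ratio_indep t lx lz) //.
apply/esym/ratio_indep => // -[d zE]; apply: zx; exists (d * c).
by rewrite zE yE scalerA.
Qed.

(** The common ratio is the automorphism. So far [aff] is additive on independent pairs only, so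
    additivity of the ratio uses an auxiliary [y] independent of [x]. *)
Lemma aff_semilinear : exists h : {rmorphism K -> K},
  forall x t, l x = 0 -> aff (t *: x) = h t *: aff x.
Proof.
have [x lx /ker_neq0 x0] := ker_proper (linear0 l).
have [y ly yx] := ker_proper lx; have y0 := ker_neq0 yx.
have Bx0 : aff x != 0 by apply: contra_neq x0; exact: aff_eq0.
have BxI : injective ( *:%R^~ (aff x)).
  move=> a b /eqP; rewrite -subr_eq0 -scalerBl scaler_eq0 (negbTE Bx0) orbF.
  by rewrite subr_eq0 => /eqP.
have hP z t : l z = 0 -> aff (t *: z) = ratio x t *: aff z.
  move=> lz; have [->|z0] := eqVneq z 0; first by rewrite scaler0 aff0 scaler0.
  by rewrite ratioP // (ratio_const t lz lx).
have lZ z t : l z = 0 -> l (t *: z) = 0 by rewrite linearZ /= => ->; rewrite mulr0.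
have h0 : ratio x 0 = 0 by apply: BxI; rewrite -hP // !scale0r aff0.
(* [(s + t) x + y = s x + (t x + y)], both sides being sums of independent pairs *)
have hD s t : ratio x (s + t) = ratio x s + ratio x t.
  have affD z u : l z = 0 -> (forall c, z <> c *: x) ->
      aff (u *: x + z) = aff (u *: x) + aff z.
    move=> lz zx; have [->|u0] := eqVneq u 0; first by rewrite scale0r aff0 !add0r.
    apply: aff_add_indep; rewrite ?lZ ?scaler_eq0 ?negb_or ?u0 //.
    by move=> [c zE]; apply: (zx (c * u)); rewrite zE scalerA.
  have ny c : y <> c *: x by move=> yE; apply: yx; exists c.
  apply: BxI; rewrite -hP //=; apply: (addIr (aff y)).
  rewrite -affD // scalerDl -addrA affD //.
  - by rewrite affD // !hP // scalerDl addrA.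
  - by rewrite linearD ly lZ ?addr0.
  move=> c yE; apply: (ny (c - t)); rewrite scalerBl -yE.
  by rewrite addrAC subrr add0r.
have h1 : ratio x 1 = 1 by apply: BxI; rewrite -hP // !scale1r.
have hM s t : ratio x (s * t) = ratio x s * ratio x t.
  by apply: BxI; rewrite -hP // -!scalerA hP ?lZ // hP.
pose hA := GRing.isNmodMorphism.Build K K (ratio x) (conj h0 hD).
pose hMM := GRing.isMonoidMorphism.Build K K (ratio x) (conj h1 hM).
pose h : {rmorphism K -> K} := HB.pack (ratio x) hA hMM.
by exists h => z t lz; rewrite hP.
Qed.

Lemma fundamental_theorem : exists (h : {rmorphism K -> K}) (A : V -> W),
  [/\ bijective h, bijective A, {morph A : x y / x + y},
      forall t x, A (t *: x) = h t *: A x &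
      forall x, exists2 c, c != 0 & phi x = c *: A x].
Proof.
have [h hP] := aff_semilinear.
have affD x y : l x = 0 -> l y = 0 -> aff (x + y) = aff x + aff y.
  move=> lx ly; have [->|x0] := eqVneq x 0; first by rewrite aff0 !add0r.
  have [[c ->]|] := pselect (exists c, y = c *: x); last exact: aff_add_indep.
  rewrite -[X in X + _]scale1r -scalerDl !hP // rmorphD rmorph1.
  by rewrite scalerDl scale1r.
(* The semilinear extension of [aff] from the hyperplane that sends [e] to [e']. *)
pose A x := h (l x) *: e' + aff (x - l x *: e).
have lk x : l (x - l x *: e) = 0 by rewrite linearB linearZ /= le1 mulr1 subrr.
have AD : {morph A : x y / x + y}.
  move=> x y; rewrite /A linearD rmorphD scalerDl scalerDl opprD addrACA.
  rewrite [aff (_ + _)]affD //.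
  exact: addrACA.
have AZ t x : A (t *: x) = h t *: A x.
  rewrite /A linearZ /= rmorphM scalerDr -scalerA; congr (_ + _).
  by rewrite -hP // scalerBr scalerA.
have A_ker x : l x = 0 -> A x = aff x.
  by move=> lx; rewrite /A lx rmorph0 !scale0r subr0 add0r.
have Ae : A e = e' by rewrite /A le1 rmorph1 !scale1r subrr aff0 addr0.
have AP x : exists2 c, c != 0 & phi x = c *: A x.
  have [lx|lx] := eqVneq (l x) 0.
    have [c c0 BE] := aff_line lx; exists c^-1; rewrite ?invr_eq0 //.
    by rewrite A_ker // BE scalerA mulVf ?scale1r.
  pose w := (l x)^-1 *: x - e.
  have lw : l w = 0 by rewrite linearB linearZ /= le1 mulVf ?subrr.
  have xE : x = l x *: (e + w) by rewrite addrC subrK scalerA divff // scale1r.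
  have [a a0 wE] := aff_spec lw.
  have [c cE] : exists c, phi x = c *: phi (e + w).
    by apply/phi_line; exists (l x).
  have AxE : A x = h (l x) *: (e' + aff w) by rewrite {1}xE AZ AD Ae A_ker.
  have hl0 : h (l x) != 0 by rewrite fmorph_eq0.
  exists (c * a / h (l x)); last by rewrite cE wE AxE !scalerA divfK.
  rewrite !mulf_neq0 ?invr_eq0 //; apply: contra_neq lx => c0.
  have /phi_eq0 -> : phi x = 0 by rewrite cE c0 scale0r.
  exact: linear0.
have A_eq0 x : A x = 0 -> x = 0.
  by have [c _ cE] := AP x => Ax0; apply/phi_eq0; rewrite cE Ax0 scaler0.
(* The point [e' + m *: aff w] comes from some [z = a *: e + b *: w]; comparing coefficients with
   those of [A z] gives [m = h (b / a)]. *)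
have h_surj m : exists a, h a = m.
  have [w lw /ker_neq0 w0] := ker_proper (linear0 l).
  have [z [c cE]] := phi_surj (e' + m *: aff w).
  have [d d0 dE] := AP z.
  have [a [b zE]] : in_span2 e w z.
    have [k k0 wE] := aff_line lw.
    apply/phi_span; have c0 : c != 0.
      apply/eqP => c0; have : (- m) *: aff w = 1 *: e'.
        by apply/eqP; rewrite scale1r scaleNr eq_sym -addr_eq0 cE c0 scale0r.
      by move/(aff_ker lw)/eqP; rewrite oner_eq0.
    exists c^-1, (c^-1 * m * k); apply: (scalerI c0).
    by rewrite -cE wE scalerDr !scalerA !mulrA divff // mul1r scale1r.
  have E : (m - c * d * h b) *: aff w = (c * d * h a - 1) *: e'.
    apply/eqP; rewrite !scalerBl scale1r subr_eq addrAC eq_sym subr_eq.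
    by rewrite [eqbRHS]addrC cE dE zE AD !AZ Ae A_ker // !scalerDr !scalerA !mulrA.
  have := aff_ker lw E => /eqP; rewrite subr_eq0 => /eqP cd1.
  have Bw0 : aff w != 0 by apply: contra_neq w0; exact: aff_eq0.
  move/eqP: E; rewrite cd1 subrr scale0r scaler_eq0 (negbTE Bw0) orbF subr_eq0.
  move=> /eqP ->; exists (b / a); rewrite fmorph_div.
  have ha0 : h a != 0.
    by apply/eqP => ha0; move/eqP: cd1; rewrite ha0 mulr0 eq_sym oner_eq0.
  by rewrite -[c * d](mulfK ha0) cd1 mul1r mulrC.
exists h, A; split=> //.
- have [g gP] := choice h_surj; exists g => // x; apply: (fmorph_inj h).
  by rewrite gP.
- have Asurj y : exists x, A x = y.
    have [x [c ->]] := phi_surj y; have [d _ ->] := AP x.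
    have [a ha] := h_surj (c * d); exists (a *: x).
    by rewrite AZ ha scalerA.
  have [g gP] := choice Asurj; exists g => // x.
  apply/eqP; rewrite -subr_eq0; apply/eqP/A_eq0.
  by rewrite AD -scaleN1r AZ rmorphN1 scaleN1r gP subrr.
Qed.

End FundamentalTheorem.

(** * The Hahn-Banach theorem *)

Section HahnBanach.
Variables (R : realType) (K : numFieldType) (iota : {rmorphism R -> K}).
Variables (U : lmodType K).
Implicit Types (p q u : U -> R) (x y : U).
Local Open Scope classical_set_scope.

(** Real scalars act through [iota], so one argument serves real spaces and complex spaces viewed as
    real ones. *)
Definition sublinear p : Prop :=
  (forall x y, p (x + y) <= p x + p y) /\
  (forall t x, 0 <= t -> p (iota t *: x) = t * p x).

Lemma sublinear0 p : sublinear p -> p 0 = 0.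
Proof. by move=> [_ pZ]; rewrite -(scaler0 _ (iota 0)) pZ ?mul0r. Qed.

Lemma sublinearN p x : sublinear p -> - p (- x) <= p x.
Proof.
move=> sp; rewrite -subr_ge0 opprK -(sublinear0 sp) -[X in p X](subrr x).
exact: sp.1.
Qed.

(* Minimal sublinear functionals are linear because [tilt q y] is sublinear,
   below [q], and at most [- q y] at [- y]. *)
Definition tilt q y x : R :=
  inf [set q (x + iota t *: y) - t * q y | t in [set t | 0 <= t]].

Section Tilt.
Variables (q : U -> R) (sq : sublinear q) (y : U).

Lemma tilt_has_lbound x :
  lbound [set q (x + iota t *: y) - t * q y | t in [set t | 0 <= t]] (- q (- x)).
Proof.
move=> _ [t /= t0 <-]; rewrite lerBrDr addrC lerBlDr -sq.2 //.
have {1}-> : iota t *: y = x + iota t *: y + - x by rewrite addrAC subrr add0r.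
exact: sq.1.
Qed.

Lemma tilt_le x t : 0 <= t -> tilt q y x <= q (x + iota t *: y) - t * q y.
Proof.
move=> t0; apply: ge_inf; last by exists t.
by exists (- q (- x)); exact: tilt_has_lbound.
Qed.

Lemma le_tilt x (c : R) :
  (forall t, 0 <= t -> c <= q (x + iota t *: y) - t * q y) -> c <= tilt q y x.
Proof.
move=> cP; apply: lb_le_inf; last by move=> _ [t t0 <-]; exact: cP.
by exists (q (x + iota 0 *: y) - 0 * q y), 0 => //=.
Qed.

Lemma tilt_le_self x : tilt q y x <= q x.
Proof.
by have := tilt_le x (lexx 0); rewrite rmorph0 scale0r addr0 mul0r subr0.
Qed.

Lemma tilt_opp : tilt q y (- y) <= - q y.
Proof.
have := tilt_le (- y) ler01.
by rewrite rmorph1 scale1r addNr sublinear0 // mul1r sub0r.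
Qed.

(** For subadditivity, parameters [s] and [t] for the summands give [s + t] for the sum. For
    homogeneity, replace [t] by [t / s]; the reverse inequality is the same one for [s^-1]. *)
Lemma sublinear_tilt : sublinear (tilt q y).
Proof.
have le_scale s x : 0 < s -> s * tilt q y x <= tilt q y (iota s *: x).
  move=> s0; apply: le_tilt => t t0; rewrite -ler_pdivlMl //.
  apply: le_trans (tilt_le x (divr_ge0 t0 (ltW s0))) _.
  rewrite ler_pdivlMl // mulrBr -(sq.2 _ _ (ltW s0)) scalerDr scalerA -rmorphM.
  by rewrite mulrCA divff ?gt_eqF // mulr1 mulrA [s * _]mulrC divfK ?gt_eqF.
split=> [x z|s x].
  rewrite -lerBlDr; apply: le_tilt => s s0; rewrite lerBlDr -lerBlDl.
  apply: le_tilt => t t0; rewrite lerBlDl.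
  apply: le_trans (tilt_le _ (addr_ge0 s0 t0)) _.
  rewrite rmorphD scalerDl mulrDl opprD addrACA [leRHS]addrACA lerD2r.
  exact: sq.1.
rewrite le_eqVlt => /orP[/eqP <-|s0].
  rewrite rmorph0 scale0r mul0r; apply/eqP; rewrite eq_le; apply/andP; split.
    by rewrite -(sublinear0 sq) tilt_le_self.
  apply: le_tilt => t t0; apply: le_trans (tilt_has_lbound _); last by exists t.
  by rewrite oppr0 sublinear0 ?oppr0.
apply/eqP; rewrite eq_le le_scale // andbT -ler_pdivrMl //.
apply: le_trans (le_scale s^-1 (iota s *: x) _) _; first by rewrite invr_gt0.
by rewrite scalerA -rmorphM mulVf ?gt_eqF // rmorph1 scale1r.
Qed.

End Tilt.

(** The pointwise infimum is finite, being at least [- p (- x)]. It is subadditive because the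
    smaller of two members of the chain can be used for both summands. *)
Lemma sublinear_chain_inf p (C : set (U -> R)) :
  (forall q, C q -> sublinear q /\ forall x, q x <= p x) -> C !=set0 ->
  (forall q r, C q -> C r -> (forall x, q x <= r x) \/ (forall x, r x <= q x)) ->
  exists q, sublinear q /\ forall r, C r -> forall x, q x <= r x.
Proof.
move=> Cp [q0 Cq0] Ctot; pose I x := inf [set r x | r in C].
have lbI x : lbound [set r x | r in C] (- p (- x)).
  move=> _ [r Cr <-]; have [sr rp] := Cp r Cr.
  by apply: le_trans (sublinearN x sr); rewrite lerN2.
have I_le r x : C r -> I x <= r x.
  move=> Cr; apply: ge_inf; last by exists r.
  by exists (- p (- x)); exact: lbI.
have le_I x c : (forall r, C r -> c <= r x) -> c <= I x.
  move=> cP; apply: lb_le_inf; last by move=> _ [r Cr <-]; exact: cP.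
  by exists (q0 x), q0.
exists I; split=> [|r Cr x]; last exact: I_le.
split=> [x y|t x t0].
  rewrite -lerBlDr; apply: (le_I) => r Cr; rewrite lerBlDr -lerBlDl.
  apply: (le_I) => s Cs; rewrite lerBlDl.
  have [rs|sr] := Ctot r s Cr Cs.
    apply: le_trans (I_le _ _ Cr) _; apply: le_trans ((Cp r Cr).1.1 x y) _.
    by rewrite lerD2l.
  apply: le_trans (I_le _ _ Cs) _; apply: le_trans ((Cp s Cs).1.1 x y) _.
  by rewrite lerD2r.
apply/eqP; rewrite eq_le; apply/andP; split.
  move: t0; rewrite [0 <= t]le_eqVlt => /orP[/eqP <-|t0].
    rewrite rmorph0 scale0r mul0r -(sublinear0 (Cp q0 Cq0).1); exact: I_le.
  rewrite -ler_pdivrMl //; apply: (le_I) => r Cr; rewrite ler_pdivrMl //.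
  by rewrite -((Cp r Cr).1.2 _ _ (ltW t0)); exact: I_le.
apply: (le_I) => r Cr; rewrite (Cp r Cr).1.2 //.
by rewrite ler_wpM2l // I_le.
Qed.

(** Zorn's lemma for the reversed pointwise order; [p] itself bounds the empty chain. *)
Lemma exists_minimal_sublinear p : sublinear p ->
  exists q, [/\ sublinear q, forall x, q x <= p x &
    forall r, sublinear r -> (forall x, r x <= q x) -> r = q].
Proof.
move=> sp; pose T := {q | sublinear q /\ forall x, q x <= p x}.
pose ge (q r : T) := `[< forall x, proj1_sig r x <= proj1_sig q x >].
have [||[q sq] [r sr]|C Ctot|q qmin] := @Zorn T ge.
- by move=> q; apply/asboolP.
- move=> q r s /asboolP qr /asboolP rs; apply/asboolP => x.
  exact: le_trans (rs x) (qr x).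
- move=> /asboolP qr /asboolP rq; apply: eq_exist; apply/funext => x /=.
  by apply/le_anti; rewrite qr rq.
- have [[q0 Cq0]|C0] := pselect (C !=set0); last first.
    exists (exist _ p (conj sp (fun x => lexx _))) => s Cs.
    by case: C0; exists s.
  have [|||q [sq qle]] := @sublinear_chain_inf p (sval @` C).
  + by move=> _ [[r rP] _ <-].
  + by exists (sval q0), q0.
  + move=> _ _ [r Cr <-] [s Cs <-].
    by have [/asboolP|/asboolP] := Ctot r s Cr Cs; [right|left].
  have qp x : q x <= p x.
    by apply: le_trans (qle _ _ x) ((svalP q0).2 x); exists q0.
  exists (exist _ q (conj sq qp)) => s Cs; apply/asboolP => x.
  by apply: qle; exists s.
exists (sval q); have [sq qp] := svalP q; split=> // r sr rq.
have rp x : r x <= p x by apply: le_trans (rq x) (qp x).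
by rewrite -(qmin (exist _ r (conj sr rp))) //; apply/asboolP.
Qed.

(** Take [u] minimal below [tilt p x0]. Minimality gives [tilt u x = u], so [u] is odd, and an odd
    sublinear functional is additive. Starting from the tilt rather than from [p] forces
    [u x0 = p x0]. *)
Theorem hahn_banach p x0 : sublinear p ->
  exists u, [/\ {morph u : x y / x + y},
    forall t x, u (iota t *: x) = t * u x,
    forall x, u x <= p x & u x0 = p x0].
Proof.
move=> sp; have [u [su ule umin]] := exists_minimal_sublinear (sublinear_tilt sp x0).
have uN x : u (- x) = - u x.
  apply/eqP; rewrite eq_le lerNl sublinearN // andbT.
  rewrite -{1}(umin _ (sublinear_tilt su x) (tilt_le_self su x)).
  exact: tilt_opp.
exists u; split.
- move=> x y; apply/eqP; rewrite eq_le su.1 /= -[leRHS]opprK -uN lerNr !opprD.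
  by rewrite -!uN su.1.
- move=> t x; have [t0|/ltW t0] := leP 0 t; first exact: su.2.
  by apply: oppr_inj; rewrite -uN -scaleNr -rmorphN su.2 ?oppr_ge0 // mulNr.
- by move=> x; apply: le_trans (ule x) _; exact: tilt_le_self.
apply/eqP; rewrite eq_le (le_trans (ule x0)) ?tilt_le_self //=.
by rewrite -lerN2 -uN; apply: le_trans (ule _) _; exact: tilt_opp.
Qed.

End HahnBanach.

(** * Bounded functionals and norming functionals *)

Section DualTheory.
Variables (K : numFieldType) (X : normedModType K).
Implicit Types (f g : dual X) (x y : X).

Lemma dual_linear f : linear (dual_fun f).
Proof. by case: f => f /= /asboolP[]. Qed.

HB.instance Definition _ f :=
  GRing.isLinear.Build K X K^o *%R (dual_fun f) (dual_linear f).

Lemma dual_le f : exists2 M, 0 < M & forall x, `|f x| <= M * `|x|.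
Proof.
case: f => f /= /asboolP[_ [M fM]]; exists (1 + `|M|); first by rewrite ltr_wpDr.
(* [M] need not be nonnegative, but its product with the norm of [x] is, since it bounds a norm. *)
move=> x; have fx := fM x; have : `|M * `|x| | = M * `|x|.
  by rewrite ger0_norm //; apply: le_trans fx.
rewrite normrM normr_id => ME.
by apply: (le_trans fx); rewrite -ME mulrDl lerDr mulr_ge0.
Qed.

Lemma exists_dual (f : X -> K) (M : K) : {morph f : x y / x + y} ->
  (forall t x, f (t *: x) = t * f x) -> (forall x, `|f x| <= M * `|x|) ->
  exists g, forall x, g x = f x.
Proof.
move=> fD fZ fM; have bf : (f : X -> K^o) \in @bounded_functional _ X.
  by apply/asboolP; split; [move=> a x y; rewrite fD fZ|exists M].
by exists (Dual bf).
Qed.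

Lemma dual_eq0 f : (f == 0) = `[< forall x, f x = 0 >].
Proof.
apply/eqP/asboolP => [-> //|f0].
by apply: val_inj; apply/funext => x; exact: f0.
Qed.

Lemma dualZE (a : K) f x : (a *: f) x = a * f x.
Proof. by []. Qed.

Lemma dualBE f g x : (f - g) x = f x - g x.
Proof. by []. Qed.

End DualTheory.

(* The constant 2 leaves room for [`|u x| + `|u ('i *: x)|], the crude bound on the
   complex functional with real part [u]. *)
Definition norming_dual (K : numFieldType) (X : normedModType K) : Prop :=
  forall x0 : X, exists f : dual X,
    (forall x, `|f x| <= 2 * `|x|) /\ `|x0| <= `|f x0|.

Lemma real_norming_dual (R : realType) (X : normedModType R) : norming_dual X.
Proof.
move=> x0; have [|u [uD uZ ule ux0]] := @hahn_banach R R idfun X Num.norm x0.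
  split=> [x y|t x t0]; first exact: ler_normD.
  by rewrite normrZ ger0_norm.
have ule' x : `|u x| <= 1 * `|x|.
  rewrite mul1r ler_norml ule andbT lerNl -mulN1r -uZ scaleN1r.
  by rewrite -normrN ule.
have [f fE] := exists_dual uD uZ ule'.
exists f; split=> [x|]; rewrite fE; last by rewrite ux0 normr_id.
by apply: le_trans (ule' x) _; rewrite ler_wpM2r // ler1n.
Qed.

Section ComplexNorming.
Variables (R : realType) (X : normedModType R[i]).

Lemma normcRe (x : X) : `|x| = (complex.Re `|x|)%:C%C.
Proof. by rewrite RRe_real // ger0_real. Qed.

Lemma complex_norming_dual : norming_dual X.
Proof.
move=> x0; pose p (x : X) := complex.Re `|x|.
have [|u [uD uZ ule ux0]] := @hahn_banach R R[i] (real_complex R) X p x0.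
  split=> [x y|t x t0].
    by rewrite /p -lecR rmorphD /= -!normcRe ler_normD.
  by rewrite /p normrZ ger0_norm ?ler0c // normcRe -rmorphM.
have uN x : u (- x) = - u x by rewrite -scaleN1r -(rmorphN1 (real_complex R)) uZ mulN1r.
have ule' x : `|u x|%:C%C <= `|x|.
  rewrite normcRe lecR ler_norml ule andbT lerNl -uN.
  by apply: le_trans (ule _) _; rewrite /p normrN.
(* The complex-linear functional with real part [u]. *)
pose f (x : X) : R[i] := (u x)%:C%C - 'i%C * (u ('i%C *: x))%:C%C.
have fD : {morph f : x y / x + y}.
  by move=> x y; rewrite /f scalerDr !uD !rmorphD mulrDr opprD addrACA.
have fZ t x : f (t *: x) = t * f x.
  have tE y : u (t *: y) = complex.Re t * u y + complex.Im t * u ('i%C *: y).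
    by rewrite {1}[t]complexE scalerDl uD uZ [_ * _%:C%C]mulrC -scalerA uZ.
  rewrite /f scalerA [_ * t]mulrC -scalerA !tE scalerA -expr2 sqr_i scaleN1r uN.
  case: t {tE} => a b /=; move: (u x) (u _) => v w.
  by apply/eqP; rewrite eq_complex /=; apply/andP; split; apply/eqP; ring.
have fle x : `|f x| <= 2 * `|x|.
  apply: le_trans (ler_normB _ _) _; rewrite mulr_natl mulr2n lerD //.
    by rewrite normc_def /= expr0n addr0 sqrtr_sqr.
  have -> : `|x| = `|'i%C *: x|.
    by rewrite normrZ normc_def /= expr0n expr1n add0r sqrtr1 mul1r.
  by rewrite normrM !normc_def /= !expr0n expr1n add0r addr0 sqrtr1 mul1r sqrtr_sqr.
have [g gE] := exists_dual fD fZ fle.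
exists g; split=> [x|]; rewrite gE //.
apply: le_trans (normc_ge_Re _); rewrite normcRe lecR.
have -> : complex.Re (f x0) = u x0 by rewrite /f /=; ring.
by rewrite ux0; exact: ler_norm.
Qed.

End ComplexNorming.

(** * From orthogonality to semilinear maps *)

Section RayTheory.
Variables (K : fieldType) (V : lmodType K).
Implicit Types x y : V.

Lemma ray_of_eq x y : ray_of x = ray_of y <-> exists2 c : K, c != 0 & y = c *: x.
Proof.
split=> [/(congr1 (@set_of_ray K V)) /= xy|[c c0 ->]].
  have : ray_set y y by exists 1; rewrite ?scale1r //= oner_neq0.
  by rewrite -xy => -[c c0 <-]; exists c.
have E : ray_set x = ray_set (c *: x).
  apply/seteqP; split=> _ [a /= a0 <-].
    by exists (a / c); rewrite ?scalerA ?divfK //= mulf_neq0 ?invr_eq0.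
  by exists (a * c); rewrite ?scalerA //= mulf_neq0.
rewrite /ray_of; case: _ / E (ex_intro _ (c *: x) _) => p.
by congr Ray; exact: Prop_irrelevance.
Qed.

Lemma ray_of_surj (r : ray V) : exists x, r = ray_of x.
Proof.
case: r => s [x E]; exists x; rewrite /ray_of; subst s.
by congr Ray; exact: Prop_irrelevance.
Qed.

End RayTheory.

Lemma ray_orthE (K : numFieldType) (X : normedModType K) (x : X) (f : dual X) :
  ray_orth (ray_of x) (ray_of f) <-> f x = 0.
Proof.
split=> [|fx _ _ [a _ <-] [b _ <-]].
  by apply; exists 1; rewrite ?scale1r //= oner_neq0.
by rewrite dualZE linearZ /= fx !mulr0.
Qed.

Section Representatives.
Variables (K : numFieldType) (X : normedModType K).
Hypothesis separating : forall x : X, (forall f : dual X, f x = 0) -> x = 0.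

Lemma exists_dual1 (x : X) : x != 0 -> exists f : dual X, f x = 1.
Proof.
move=> x0; have [f /eqP fx] : exists f : dual X, f x <> 0.
  by apply/existsNP => fx; move/eqP: x0; apply; exact: separating.
by exists ((f x)^-1 *: f); rewrite dualZE mulVf.
Qed.

(** Subtract from any [f] the combination of functionals biorthogonal to [x] and [y] that makes it
    vanish at both. The result kills [z], so [f] cannot tell [z] from a fixed combination of [x] and
    [y]. *)
Lemma in_span2_dual (x y z : X) :
  in_span2 x y z <-> forall f : dual X, f x = 0 -> f y = 0 -> f z = 0.
Proof.
split=> [[a [b ->]] f fx fy|fz].
  by rewrite linearD !linearZ /= fx fy !mulr0 addr0.
have [x0|x0] := eqVneq x 0.
  have [y0|y0] := eqVneq y 0.
    exists 0, 0; rewrite !scale0r addr0.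
    by apply: separating => f; apply: fz; rewrite ?x0 ?y0 linear0.
  have [g gy] := exists_dual1 y0; exists 0, (g z).
  rewrite x0 scaler0 add0r; apply/eqP; rewrite -subr_eq0; apply/eqP.
  apply: separating => f; rewrite linearB linearZ /=.
  have := fz (f - f y *: g); rewrite !dualBE !dualZE x0 !linear0 mulr0 subr0 gy.
  by rewrite mulr1 subrr mulrC; apply.
have [g gx] := exists_dual1 x0; pose y' := y - g y *: x.
have [y'0|y'0] := eqVneq y' 0.
  exists (g z), 0; rewrite scale0r addr0; apply/eqP; rewrite -subr_eq0; apply/eqP.
  apply: separating => f; rewrite linearB linearZ /=.
  have := fz (f - f x *: g); rewrite !dualBE !dualZE gx mulr1 subrr.
  rewrite [f x * g z]mulrC; apply => //.
  move/(congr1 f)/eqP: y'0; rewrite /y' linearB linearZ linear0 /= subr_eq0 => /eqP ->.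
  by rewrite mulrC subrr.
have [g2 g2x g2y] : exists2 g2 : dual X, g2 x = 0 & g2 y = 1.
  have [k ky'] := exists_dual1 y'0; exists (k - k x *: g).
    by rewrite dualBE dualZE gx mulr1 subrr.
  rewrite dualBE dualZE; move: ky'; rewrite /y' linearB linearZ /=.
  by rewrite [k x * _]mulrC.
(* [g - g y *: g2] is 1 at [x] and 0 at [y], so its value at [z] is the coefficient of [x]. *)
have [a aE] : exists a : K, a = g z - g y * g2 z by exists (g z - g y * g2 z).
exists a, (g2 z); apply/eqP; rewrite -subr_eq0; apply/eqP.
apply: separating => f.
have := fz (f - f x *: (g - g y *: g2) - f y *: g2).
rewrite !(dualBE, dualZE) gx g2x g2y -aE => H.
by rewrite linearB linearD !linearZ /= -[RHS]H; ring.
Qed.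

Variables (T : ray X -> ray X) (S : ray (dual X) -> ray (dual X)).
Hypothesis dimX : dim_ge X 3.
Hypotheses (Tbij : bijective T) (Sbij : bijective S) (TS : preserves_orth T S).

Theorem orth_preserving_semilinear :
  exists (h : {rmorphism K -> K}) (A : X -> X),
  [/\ bijective h, bijective A, is_semilinear h A, induced_by T S h A &
      forall f : dual X, exists g : dual X, forall x, f (A x) = h (g x)].
Proof.
have [phi TE] := choice (fun x => ray_of_surj (T (ray_of x))).
have [psi SE] := choice (fun f => ray_of_surj (S (ray_of f))).
have orth x f : psi f (phi x) = 0 <-> f x = 0 by rewrite -!ray_orthE -TE -SE.
have surj (U : lmodType K) (F : ray U -> ray U) (k : U -> U) : bijective F ->
    (forall x, F (ray_of x) = ray_of (k x)) ->
    forall y, exists x, exists2 c, c != 0 & y = c *: k x.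
  move=> [F' FK F'K] FE y; have [x xE] := ray_of_surj (F' (ray_of y)).
  by exists x; apply/ray_of_eq; rewrite -FE -xE F'K.
have phi_surj := surj _ _ _ Tbij TE; have psi_surj := surj _ _ _ Sbij SE.
have phi_eq0 x : phi x = 0 <-> x = 0.
  split=> [x0|->]; apply: separating => f.
    by apply/orth; rewrite x0 linear0.
  by have [g [c _ ->]] := psi_surj f; rewrite dualZE (orth _ _).2 ?mulr0 ?linear0.
(* Collinearity is a condition on annihilators, which [orth] transports; every functional is a
   multiple of some [psi g]. *)
have phi_span x y z : in_span2 (phi x) (phi y) (phi z) <-> in_span2 x y z.
  rewrite !in_span2_dual; split=> H f.
    by move=> /orth fx /orth fy; apply/orth; exact: H.
  have [g [c c0 ->]] := psi_surj f; rewrite !dualZE => /eqP + /eqP.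
  rewrite !mulf_eq0 (negbTE c0) /= => /eqP/orth gx /eqP/orth gy.
  by rewrite (orth _ _).2 ?mulr0 //; exact: H.
have [e e0] : exists e : X, e != 0.
  have [e ne] := dim_ge3_span2 dimX 0 0; exists e; apply/eqP => e0.
  by apply: ne; exists 0, 0; rewrite !scale0r addr0.
have [l le1] := exists_dual1 e0.
have phi_surj' y : exists x c, y = c *: phi x.
  by have [x [c _ ->]] := phi_surj y; exists x, c.
have [h [A [hbij Abij AD AZ phiA]]] := @fundamental_theorem _ _ _ phi phi_eq0
  phi_span phi_surj' (dim_ge3_span2 dimX) (dual_fun l) e le1.
case: (Abij) => Ainv AK AinvK.
(* [h \o f \o A^-1] and [psi f] have the same kernel, hence are proportional. *)
have exB (f : dual X) : exists g : dual X,
    (forall x, g x = h (f (Ainv x))) /\ (f != 0 -> exists2 c, c != 0 & g = c *: psi f).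
  have [->|f0] := eqVneq f 0; first by exists 0; split=> // x; rewrite rmorph0.
  have [x0 /eqP fx0] : exists x, f x <> 0.
    apply/existsNP => fx; move/eqP: f0; apply; apply/eqP; rewrite dual_eq0.
    exact/asboolP.
  have psiA x : psi f (A x) = 0 <-> f x = 0.
    rewrite -(orth x f); have [c c0 ->] := phiA x; rewrite linearZ /=.
    by split=> [->|/eqP]; rewrite ?mulr0 // mulf_eq0 (negbTE c0) /= => /eqP.
  have [x1 fx1] : exists x1, f x1 = 1.
    by exists ((f x0)^-1 *: x0); rewrite linearZ /= mulVf.
  have psi1 : psi f (A x1) != 0.
    by apply/eqP => /psiA/eqP; rewrite fx1 oner_eq0.
  exists ((psi f (A x1))^-1 *: psi f); split=> [y|_]; last first.
    by exists (psi f (A x1))^-1; rewrite ?invr_eq0.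
  rewrite dualZE; have /psiA : f (Ainv y - f (Ainv y) *: x1) = 0.
    by rewrite linearB linearZ /= fx1 mulr1 subrr.
  rewrite AD -scaleN1r !AZ rmorphN1 scaleN1r AinvK linearB linearZ /= => /eqP.
  by rewrite subr_eq0 => /eqP ->; rewrite mulrC mulfK.
have [B BP] := choice exB.
have Bray (f : dual X) : f != 0 -> S (ray_of f) = ray_of (B f).
  by move=> f0; rewrite SE; apply/ray_of_eq; have [_ /(_ f0)] := BP f.
exists h, A; split=> //.
- exists Ainv, B; split=> // [f x|x _]; first exact: (BP f).1.
  rewrite TE; apply/esym/ray_of_eq; exact: phiA.
move=> f; have [->|f0] := eqVneq f 0; first by exists 0 => x; rewrite rmorph0.
(* Write [f = c *: psi g] and [B g = d *: psi g]; then [f \o A] is [c / d] times [h \o g], and the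
   factor is absorbed through [hinv]. *)
have [g [c c0 fE]] := psi_surj f.
have g0 : g != 0.
  apply/eqP => gE; case/eqP: f0; apply/eqP; rewrite dual_eq0; apply/asboolP => y.
  have [x [b _ ->]] := phi_surj y; rewrite fE gE dualZE.
  by rewrite linearZ /= (orth x 0).2 ?mulr0.
have [BgE /(_ g0)[d d0 dE]] := BP g.
case: hbij => hinv hK hinvK; exists (hinv (c / d) *: g) => x.
by rewrite dualZE rmorphM hinvK -[in h (g x)](AK x) -BgE dE dualZE mulrA divfK // fE.
Qed.

End Representatives.

(** The factor between [A1 x] and [A2 x] agrees at independent [x] and [y] by comparison with
    [x + y], and in general through a third vector. Allowing [h1] and [h2] to differ covers a linear
    operator against a conjugate-linear one. *)
Lemma semilinear_unique (K : numFieldType) (X : lmodType K) (h1 h2 : K -> K)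
    (A1 A2 : X -> X) :
  dim_ge X 3 -> (forall a, exists b, h1 b = a) -> injective A1 -> 
  is_semilinear h1 A1 -> is_semilinear h2 A2 ->
  (forall x, x != 0 -> ray_of (A1 x) = ray_of (A2 x)) ->
  exists2 c : K, c != 0 & forall x, A2 x = c *: A1 x.
Proof.
move=> dimX h1s A1i [A1D A1Z] [A2D A2Z] Aray.
have /choice[k kP] x : exists c : K, x != 0 -> c != 0 /\ A2 x = c *: A1 x.
  have [_|/Aray/ray_of_eq[c c0 ->]] := eqVneq x 0; first by exists 0.
  by exists c.
have A10 : A1 0 = 0 by apply: (addrI (A1 0)); rewrite -A1D !addr0.
have A20 : A2 0 = 0 by apply: (addrI (A2 0)); rewrite -A2D !addr0.
have k_indep x y : x != 0 -> ~ (exists c, y = c *: x) -> k x = k y.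
  move=> x0 yx; have y0 := ker_neq0 yx.
  have xy0 : x + y != 0.
    apply/eqP => xy; apply: yx; exists (-1).
    by rewrite scaleN1r; apply/eqP; rewrite -addr_eq0 addrC xy.
  have E : (k (x + y) - k x) *: A1 x = (k y - k (x + y)) *: A1 y.
    have := (kP _ xy0).2; rewrite A2D A1D (kP _ x0).2 (kP _ y0).2 scalerDr => E.
    apply/eqP; rewrite !scalerBl subr_eq addrAC eq_sym subr_eq.
    by rewrite addrC E.
  have ky : k y - k (x + y) = 0.
    apply/eqP; apply: contrapT => /negP ne; apply: yx.
    have [b bE] := h1s ((k y - k (x + y))^-1 * (k (x + y) - k x)).
    exists b; apply: A1i; rewrite A1Z bE -scalerA E scalerA mulVf ?scale1r //.
  move/eqP: E; rewrite ky scale0r scaler_eq0 => /orP[|/eqP A1x].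
    by rewrite subr_eq0 => /eqP <-; apply/eqP; rewrite eq_sym -subr_eq0 ky.
  by case/eqP: x0; apply: A1i; rewrite A1x A10.
have k_const x y : x != 0 -> y != 0 -> k x = k y.
  move=> x0 y0; have [z zxy] := dim_ge3_span2 dimX x y.
  rewrite (@k_indep x z) //; first apply/esym/k_indep => //.
  - by move=> [c zE]; apply: zxy; exists 0, c; rewrite scale0r add0r.
  - by move=> [c zE]; apply: zxy; exists c, 0; rewrite scale0r addr0.
have [x xP] := dim_ge3_span2 dimX 0 0.
have x0 : x != 0 by apply/eqP => x0; apply: xP; exists 0, 0; rewrite !scale0r addr0.
exists (k x); first exact: (kP _ x0).1.
move=> y; have [->|y0] := eqVneq y 0; first by rewrite A10 A20 scaler0.
by rewrite (kP _ y0).2 (k_const x y).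
Qed.

(** * Completeness arguments *)

Definition archimedean_norm (K : numFieldType) : Prop :=
  forall x : K, exists n : nat, `|x| < n%:R.

Section GlidingHump.
Variables (K : numFieldType) (archK : archimedean_norm K).

(** Bernoulli's inequality reduces powers to multiples of [b - 1]. *)
Lemma archi_expr (b x : K) : 1 < b ->
  exists n, forall m, (n <= m)%N -> `|x| < b ^+ m.
Proof.
move=> b1; have b0 : 0 < b - 1 by rewrite subr_gt0.
have [n xn] := archK (x / (b - 1)).
have bernoulli m : m%:R * (b - 1) <= b ^+ m.
  elim: m => [|m IH]; first by rewrite mul0r ler01.
  rewrite -natr1 mulrDl mul1r addrC.
  have -> : b ^+ m.+1 = (b - 1) * b ^+ m + b ^+ m by rewrite exprS; ring.
  by rewrite lerD // ler_peMr ?exprn_ege1 ?(ltW b0) ?(ltW b1).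
exists n => m nm; apply: lt_le_trans (bernoulli m).
rewrite -ltr_pdivrMr //; have := xn; rewrite normrM [`|_^-1|]gtr0_norm ?invr_gt0 //.
by move/lt_le_trans; apply; rewrite ler_nat.
Qed.

Variable X : completeNormedModType K.

Lemma cvg_halving (x : nat -> X) (r : nat -> K) :
  (forall n, 0 < r n) -> (forall n, r n.+1 <= r n / 2) ->
  (forall n, `|x n.+1 - x n| <= r n / 2) ->
  exists y, forall n, `|y - x n| <= r n.
Proof.
move=> r0 rS xS.
(* The closed balls of centres [x n] and radii [r n] are nested. *)
have xr n k : `|x (n + k)%N - x n| + r (n + k)%N <= r n.
  elim: k => [|k IH]; first by rewrite addn0 subrr normr0 add0r.
  apply: le_trans IH; rewrite addnS -[x _.+1](subrK (x (n + k)%N)) -addrA.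
  apply: (@le_trans _ _ (r (n + k)%N / 2 + `|x (n + k)%N - x n| + r (n + k)%N / 2)).
    by rewrite lerD // (le_trans (ler_normD _ _)) // lerD.
  by rewrite addrAC addrC -splitr.
have xmn n m : (n <= m)%N -> `|x m - x n| <= r n.
  move=> nm; rewrite -(subnKC nm); apply: le_trans (xr n (m - n)%N).
  by rewrite lerDl ltW.
have r_exp n : r n * 2 ^+ n <= r 0.
  elim: n => [|n IH]; first by rewrite mulr1.
  apply: le_trans IH; rewrite exprS mulrA ler_wpM2r ?exprn_ge0 //.
  by rewrite -ler_pdivlMr.
have rlim e : 0 < e -> exists n, r n < e.
  move=> e0; have [n nP] := @archi_expr 2 (r 0 / e) (ltr1n _ 2).
  exists n; have := nP n (leqnn n).
  rewrite gtr0_norm ?divr_gt0 // ltr_pdivrMr // mulrC => /(le_lt_trans (r_exp n)).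
  by rewrite ltr_pM2r // exprn_gt0.
have /cauchy_cvg/cvg_ex[y xy] : cauchy (x @ \oo)%classic.
  apply: cauchy_exP => e e0; have [n ne] := rlim e e0; exists (x n), n => // m /= nm.
  by rewrite -ball_normE /= distrC; apply: le_lt_trans (xmn _ _ nm) ne.
exists y => n; apply/ler_addgt0Pr => e e0.
have [N _ /(_ (maxn n N) (leq_maxr _ _)) /= yN] := (cvgrPdist_lt _ _).1 xy e e0.
rewrite -(subrK (x (maxn n N)) y) -addrA (le_trans (ler_normD _ _)) //.
by rewrite [leRHS]addrC lerD ?xmn ?leq_maxl // ltW.
Qed.

Lemma archi_unbounded (x : K) : ~ (forall n : nat, n%:R <= `|x|).
Proof.
move=> H; have [n xn] := archK x.
by have := lt_le_trans xn (H n); rewrite ltxx.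
Qed.

Section BoundedOperator.
Hypothesis normX : norming_dual X.
Variables (h : K -> K) (A : X -> X).
Hypothesis h_norm : forall t, `|h t| = `|t|.
Hypothesis AD : {morph A : x y / x + y}.
Hypothesis AZ : forall t x, A (t *: x) = h t *: A x.
Hypothesis weakA : forall f : dual X, exists M, forall x, `|f (A x)| <= M * `|x|.

Lemma semilinear0 : A 0 = 0.
Proof. by apply: (addrI (A 0)); rewrite -AD !addr0. Qed.

Lemma semilinearN x : A (- x) = - A x.
Proof. by apply: (addrI (A x)); rewrite -AD !subrr semilinear0. Qed.

(** Take [w] of norm [r / 2] with [A w] large and [f] norming [A w]. As [f (A (x + w))] and
    [f (A (x - w))] differ by twice [f (A w)], one of them is large. Since [f \o A] is bounded, it
    stays large on a small ball. *)
Lemma unbounded_ball (n : nat) (x : X) (r : K) : ~ bounded_op A -> 0 < r ->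
  exists x' r', [/\ 0 < r', r' <= r / 2, `|x' - x| <= r / 2 &
    forall y, `|y - x'| <= r' -> n%:R <= `|A y|].
Proof.
move=> Aunb r0; pose M := (n%:R *+ 2 + 1) / (r / 2).
have r20 : 0 < r / 2 by rewrite divr_gt0.
have M0 : 0 < M by rewrite divr_gt0 // ltr_wpDl // mulrn_wge0.
have [v Mv] : exists v, M * `|v| < `|A v|.
  apply: contrapT => /forallNP noM; apply: Aunb; exists M => v.
  by rewrite real_leNgt ?ger0_real ?(mulr_ge0 (ltW M0)) //; apply/negP; exact: noM.
have v0 : 0 < `|v|.
  rewrite normr_gt0; apply: contraTneq Mv => ->.
  by rewrite semilinear0 !normr0 mulr0 ltxx.
pose w := (r / 2 / `|v|) *: v.
have wr : `|w| = r / 2.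
  by rewrite normrZ gtr0_norm ?divr_gt0 // divfK ?gt_eqF.
have Aw : n%:R *+ 2 + 1 < `|A w|.
  rewrite AZ normrZ h_norm gtr0_norm ?divr_gt0 // mulrAC ltr_pdivlMr //.
  have <- : r / 2 * M = n%:R *+ 2 + 1 by rewrite mulrC divfK ?gt_eqF.
  by rewrite -mulrA ltr_pM2l.
have [f [f2 fw]] := normX (A w).
have {fw} fw : n%:R *+ 2 + 1 < `|f (A w)| := lt_le_trans Aw fw.
have [C C0 fC] : exists2 C, 0 < C & forall x, `|f (A x)| <= C * `|x|.
  have [C fC] := weakA f; have C0 : 0 <= C.
    by rewrite -(pmulr_lge0 _ v0); apply: le_trans (fC v).
  exists (1 + C) => [|z]; first by rewrite ltr_wpDr.
  by rewrite (le_trans (fC z)) // ler_wpM2r // lerDr.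
have [x' x'r fx'] : exists2 x', `|x' - x| <= r / 2 & n%:R *+ 2 + 1 < `|f (A x')|.
  have [fp|fp] := real_ltP (ger0_real (addr_ge0 (mulrn_wge0 2 (ler0n K n)) ler01))
    (normr_real (f (A (x + w)))).
    by exists (x + w); rewrite // addrAC subrr add0r wr.
  exists (x - w); first by rewrite addrAC subrr add0r normrN wr.
  rewrite real_ltNge ?normr_real ?ger0_real ?addr_ge0 ?mulrn_wge0 //.
  apply/negP => fm; have := ltrD fw fw; apply/negP.
  rewrite -real_leNgt ?ger0_real ?addr_ge0 ?mulrn_wge0 //.
  have <- : `|f (A (x + w)) - f (A (x - w))| = `|f (A w)| + `|f (A w)|.
    rewrite -[RHS]mulr2n -normrMn !AD semilinearN !linearD linearN /=.
    by congr `|_|; ring.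
  by apply: le_trans (ler_normB _ _) _; exact: lerD.
have Cr0 : 0 < 1 + C * r by rewrite ltr_wpDr ?mulr_ge0 // ltW.
exists x', (r / 2 / (1 + C * r)); split => //; first by rewrite divr_gt0.
  by rewrite ler_pdivrMr // ler_peMr ?(ltW r20) // lerDl mulr_ge0 ?ltW.
move=> y yx'; have fyx' : `|f (A y) - f (A x')| <= 1.
  rewrite -linearB -semilinearN -AD; apply: le_trans (fC _) _.
  apply: (@le_trans _ _ (C * (r / 2 / (1 + C * r)))); first by rewrite ler_wpM2l // ltW.
  rewrite !mulrA ler_pdivrMr // mul1r ler_pdivrMr // mulr_natr mulr2n.
  by rewrite -addrA addrCA lerDl !addr_ge0 ?mulr_ge0 ?(ltW C0) ?(ltW r0).
rewrite -(@ler_pM2l _ 2) //; apply: le_trans (f2 (A y)).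
rewrite mulr_natl -(lerD2r 1); apply: (le_trans (ltW fx')).
rewrite -[X in `|X|](subrK (f (A y))) addrC (le_trans (ler_normD _ _)) //.
by rewrite lerD2l distrC.
Qed.

Lemma semilinear_bounded : bounded_op A.
Proof.
apply: contrapT => Aunb.
have /choice[F FP] (s : nat * (X * K)) : exists s' : X * K, 0 < s.2.2 ->
    [/\ 0 < s'.2, s'.2 <= s.2.2 / 2, `|s'.1 - s.2.1| <= s.2.2 / 2 &
    forall y, `|y - s'.1| <= s'.2 -> s.1%:R <= `|A y|].
  case: s => n [x r] /=; have [r0|_] := boolP (0 < r); last by exists (0, 0).
  by have [x' [r' P]] := @unbounded_ball n x r Aunb r0; exists (x', r').
pose s := fix s n : X * K := if n is m.+1 then F (m, s m) else (0, 1).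
have s0 n : 0 < (s n).2.
  by elim: n => [|n IH] /=; [exact: ltr01|have [] := FP (n, s n) IH].
have [y yP] : exists y, forall n, `|y - (s n).1| <= (s n).2.
  by apply: cvg_halving => // n; have [] := FP (n, s n) (s0 n).
apply: (@archi_unbounded (`|A y|)) => n; rewrite normr_id.
(* The lower bound [n] holds on the ball of index [n.+1]. *)
by have [_ _ _] := FP (n, s n) (s0 n); apply; exact: (yP n.+1).
Qed.

End BoundedOperator.

End GlidingHump.

(** Modulo finitely many vectors every [x] lies in the common kernel: each functional in turn either
    vanishes on the kernel of the previous ones or costs one more vector. A trivial common kernel
    would make [X] finite dimensional. *)
Lemma infinite_dim_common_zero (K : numFieldType) (X : normedModType K) :
  ~ finite_dim X -> forall s : seq (dual X),
  exists2 x : X, x != 0 & forall f, f \in s -> f x = 0.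
Proof.
move=> infX s; apply: contrapT => noker; apply: infX.
have fin (s' : seq (dual X)) : exists (n : nat) (v : 'I_n -> X), forall x : X,
    exists a : 'I_n -> K, forall f, f \in s' -> f (x - \sum_i a i *: v i) = 0.
  elim: s' => [|f s' [n [v vP]]].
    by exists 0%N, (fun=> 0) => x; exists (fun=> 0).
  have [[w ws fw]|now] := pselect (exists2 w, forall g, g \in s' -> g w = 0 & f w != 0).
    exists n.+1, (fun i => oapp v w (unlift ord0 i)) => x; have [a aP] := vP x.
    pose y := x - \sum_i a i *: v i.
    exists (fun i => oapp a (f y / f w) (unlift ord0 i)) => g.
    rewrite big_ord_recl unlift_none /= opprD addrCA addrC.
    under eq_bigr do rewrite liftK /=.
    rewrite -/y inE => /orP[/eqP ->|gs']; rewrite linearB linearZ /=.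
      by rewrite divfK // subrr.
    by rewrite (ws _ gs') mulr0 subr0 aP.
  exists n, v => x; have [a aP] := vP x; exists a => g.
  rewrite inE => /orP[/eqP ->|]; last exact: aP.
  by apply/eqP; apply: contrapT => /negP fy; apply: now; exists (x - \sum_i a i *: v i).
have [n [v vP]] := fin s; exists n, v => x; have [a aP] := vP x; exists a.
apply/eqP; rewrite -subr_eq0; apply: contrapT => /negP y0; apply: noker.
by exists (x - \sum_i a i *: v i).
Qed.

(** * Automorphisms of the scalar field *)

Section Automorphism.
Variables (K : numFieldType) (archK : archimedean_norm K) (h : {rmorphism K -> K}).

(** High powers of [t] tend to 0 while their images grow without bound. *)
Lemma rmorph_unbounded (t : K) : `|t| < 1 -> 1 < `|h t| ->
  forall d N : K, 0 < d -> exists2 u, `|u| <= d & `|N| <= `|h u|.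
Proof.
move=> t1 ht1 d N d0; have t0 : 0 < `|t|.
  by rewrite normr_gt0; apply: contraTneq ht1 => ->; rewrite rmorph0 normr0 ltr10.
have [|n nP] := @archi_expr _ archK (`|t|^-1) d^-1; first by rewrite invf_gt1.
have [m mP] := archi_expr archK N ht1.
exists (t ^+ maxn n m).
  rewrite normrX; have := nP _ (leq_maxl n m).
  rewrite [`|d^-1|]gtr0_norm ?invr_gt0 // exprVn ltf_pV2 ?posrE ?exprn_gt0 //.
  exact: ltW.
by rewrite rmorphXn normrX ltW // mP ?leq_maxr.
Qed.

Hypothesis h_contr : forall t, `|t| < 1 -> `|h t| <= 1.

(** Integers are fixed, so [n * t] and [n * h t] are both within 1 of the same integer, and
    [h t - t] has norm at most [2 / n]. *)
Lemma rmorph_fix (t : K) :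
  (forall n : nat, exists m : int, `|n%:R * t - m%:~R| < 1) -> h t = t.
Proof.
move=> tP; apply/eqP; rewrite -subr_eq0; apply: contrapT => /negP ht.
apply: (@archi_unbounded _ archK (2 / (h t - t))) => n.
rewrite normrM normfV ler_pdivlMr ?normr_gt0 // -normr_nat -normrM mulrBr.
have [m nm] := tP n; have := h_contr nm.
rewrite rmorphB rmorphM rmorph_nat rmorph_int => hm.
rewrite -(subrK m%:~R (n%:R * h t)) -addrA (le_trans (ler_normD _ _)) //.
by rewrite [leRHS]normr_nat [leRHS](_ : 2 = 1 + 1) // lerD // distrC ltW.
Qed.

End Automorphism.

(* If [h] is unbounded near [0], choose [e n] killed by the functionals chosen
   before and [f n] with [f n (e n) = 1]; along [y = \sum_n u n *: e n] with tiny
   [u n] the numbers [h (f n y)] outgrow any bound by [`|A y|]. *)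
Lemma rmorph_bounded_of_weakly_bounded (K : numFieldType) (archK : archimedean_norm K)
    (X : completeNormedModType K) (h : {rmorphism K -> K}) (A : X -> X) :
  (forall x : X, (forall f : dual X, f x = 0) -> x = 0) -> ~ finite_dim X ->
  (forall f : dual X, exists g : dual X, forall x, g (A x) = h (f x)) ->
  forall t, `|t| < 1 -> `|h t| <= 1.
Proof.
move=> sepX infX hA t t1; rewrite real_leNgt ?normr_real //; apply/negP => ht1.
have unb := rmorph_unbounded archK t1 ht1.
have /choice[G GP] (s : seq (dual X)) : exists p : X * dual X,
    [/\ p.1 != 0, forall f, f \in s -> f p.1 = 0 & p.2 p.1 = 1].
  have [x x0 xs] := infinite_dim_common_zero infX s.
  by have [f fx] := exists_dual1 sepX x0; exists (x, f).
pose s := fix s n := if n is m.+1 then (G (s m)).2 :: s m else [::].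
pose e n := (G (s n)).1; pose f n := (G (s n)).2.
have e0 n : 0 < `|e n| by rewrite normr_gt0; have [] := GP (s n).
have fe1 n : f n (e n) = 1 by have [] := GP (s n).
have mem_f n k : f n \in s (n + k.+1)%N.
  elim: k => [|k IH]; first by rewrite addn1 /= inE eqxx.
  by rewrite addnS /= inE IH orbT.
have fe0 n k : f n (e (n + k.+1)%N) = 0.
  by have [_ + _] := GP (s (n + k.+1)%N); apply; exact: mem_f.
have /choice[M MP] n : exists M : K, 0 < M /\ forall x, `|h (f n x)| <= M * `|A x|.
  have [g gP] := hA (f n); have [M M0 gM] := dual_le g.
  by exists M; split=> // x; rewrite -gP.
pose r n : K := 2^-1 ^+ n.
have r0 n : 0 < r n by rewrite exprn_gt0 // invr_gt0.
have rS n : r n.+1 = r n / 2 by rewrite /r exprSr.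
(* The coefficient is small enough for [cvg_halving], yet its image outweighs [h (f n (x n))] by
   [n * M n]. *)
have /choice[u uP] (p : nat * X) : exists u : K, `|u| <= r p.1 / 2 / `|e p.1| /\
    `|h (f p.1 p.2)| + p.1%:R * M p.1 <= `|h u|.
  have [|u ud uN] := unb (r p.1 / 2 / `|e p.1|) (`|h (f p.1 p.2)| + p.1%:R * M p.1).
    by rewrite !divr_gt0.
  exists u; split=> //; apply: le_trans uN; rewrite [leRHS]ger0_norm //.
  by rewrite addr_ge0 // mulr_ge0 // ltW // (MP p.1).1.
pose x := fix x n := if n is m.+1 then x m + u (m, x m) *: e m else 0.
have [y yP] : exists y, forall n, `|y - x n| <= r n.
  apply: (cvg_halving archK) => // n; first by rewrite rS.
  rewrite /= addrAC subrr add0r normrZ -ler_pdivlMr //.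
  exact: (uP (n, x n)).1.
have fx n k : f n (x (n + k.+1)%N) = f n (x n) + u (n, x n).
  elim: k => [|k IH]; first by rewrite addn1 /= linearD linearZ /= fe1 mulr1.
  by rewrite addnS /= linearD linearZ /= fe0 mulr0 addr0 IH.
(* By [fx], [f n] is constant along [x] after index [n]; being bounded, it keeps that value at the
   limit [y]. *)
have fy n : f n y = f n (x n) + u (n, x n).
  have [C C0 fC] := dual_le (f n).
  apply/eqP; rewrite -subr_eq0; apply: contrapT => /negP; rewrite -normr_gt0 => d0.
  have [k kP] := archi_expr archK (C / `|f n y - (f n (x n) + u (n, x n))|) (ltr1n K 2).
  have := kP (n + k.+1)%N (leq_trans (leqnSn k) (leq_addl n k.+1)).
  rewrite gtr0_norm ?divr_gt0 // ltr_pdivrMr // mulrC -(fx n k) -linearB.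
  rewrite -ltr_pdivrMr ?exprn_gt0 // => /lt_le_trans /(_ (fC _)).
  rewrite ltr_pM2l // => /lt_le_trans /(_ (yP _)).
  by rewrite /r exprVn ltxx.
apply: (@archi_unbounded _ archK (`|A y|)) => n; rewrite normr_id.
rewrite -(ler_pM2l (MP n).1) mulrC; apply: le_trans ((MP n).2 y).
have := (uP (n, x n)).2; rewrite /= fy rmorphD => uN.
rewrite -(lerD2l `|h (f n (x n))|); apply: (le_trans uN).
rewrite -[X in `|X| <= _](addKr (h (f n (x n)))).
by rewrite (le_trans (ler_normD _ _)) // normrN.
Qed.

Lemma real_archimedean (R : realType) : archimedean_norm R.
Proof. by move=> x; exists (Num.trunc `|x|).+1; exact: truncnS_gt. Qed.

Lemma complex_archimedean (R : realType) : archimedean_norm R[i].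
Proof.
move=> x; have [n xn] := real_archimedean (complex.Re `|x|); exists n.
rewrite -[`|x|]RRe_real ?normr_real // -(rmorph_nat (real_complex R)) ltcR.
exact: le_lt_trans (ler_norm _) xn.
Qed.

Lemma floor_approx (R : realType) (x : R) : `|x - (Num.floor x)%:~R| < 1.
Proof.
have /andP[xl xr] := floor_itv x.
by rewrite ger0_norm ?subr_ge0 // ltrBlDl -intrD1 addrC; rewrite addrC in xr *.
Qed.

(** Nonnegative reals are squares, so [h] is monotone and preserves the unit interval around 0;
    [rmorph_fix] then applies. *)
Lemma real_rmorph_id (R : realType) (h : {rmorphism R -> R}) : h =1 id.
Proof.
move=> t; apply: (rmorph_fix (@real_archimedean R)) => [u u1|n]; last first.
  by exists (Num.floor (n%:R * t)); exact: floor_approx.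
have h_ge0 v : 0 <= v -> 0 <= h v.
  by move=> v0; rewrite -(sqr_sqrtr v0) rmorphXn sqr_ge0.
rewrite ler_norml; move: u1; rewrite ltr_norml => /andP[/ltW u1 /ltW u2].
rewrite -subr_ge0 opprK -[in X in X && _](rmorph1 h) -rmorphD h_ge0 /=.
  by rewrite -subr_ge0 -[in X in X - _](rmorph1 h) -rmorphB h_ge0 ?subr_ge0.
by rewrite -lerBlDr sub0r.
Qed.

(** By [rmorph_fix], [h] fixes the reals, and it sends the imaginary unit to a square root of -1. *)
Lemma complex_rmorph_id_or_conj (R : realType) (h : {rmorphism R[i] -> R[i]}) :
  (forall t, `|t| < 1 -> `|h t| <= 1) -> h =1 id \/ h =1 @conjc R.
Proof.
move=> h1; have hR (a : R) : h a%:C%C = a%:C%C.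
  apply: (rmorph_fix (@complex_archimedean R) h1) => n.
  exists (Num.floor (n%:R * a)).
  rewrite -(rmorph_nat (real_complex R)) -rmorphM.
  rewrite -(rmorph_int (real_complex R)) -rmorphB normc_def /= expr0n addr0 sqrtr_sqr.
  by rewrite -[ltRHS](rmorph1 (real_complex R)) ltcR floor_approx.
have : (h 'i%C - 'i%C) * (h 'i%C + 'i%C) = 0.
  by rewrite -subr_sqr -rmorphXn sqr_i rmorphN1 subrr.
move=> /eqP; rewrite mulf_eq0 subr_eq0 addr_eq0 => /orP[]/eqP hi; [left|right] => t.
  by rewrite [t]complexE rmorphD rmorphM !hR hi.
rewrite [t]complexE rmorphD rmorphM !hR hi; case: t => a b /=.
by apply/eqP; rewrite eq_complex /=; apply/andP; split; apply/eqP; ring.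
Qed.

Lemma norming_dual_separating (K : numFieldType) (X : normedModType K) :
  norming_dual X -> forall x : X, (forall f : dual X, f x = 0) -> x = 0.
Proof.
move=> nX x fx; have [f [_ xf]] := nX x; move: xf.
by rewrite fx normr0 normr_le0 => /eqP.
Qed.

(** * Boundedness, uniqueness and the three cases *)

Lemma induced_bounded_invertible (K : numFieldType) (archK : archimedean_norm K)
    (X : completeNormedModType K) (nX : norming_dual X) (h : K -> K) (A : X -> X)
    (T : ray X -> ray X) (S : ray (dual X) -> ray (dual X)) :
  (forall t, `|h t| = `|t|) -> bijective h -> is_semilinear h A ->
  induced_by T S h A ->
  (forall f : dual X, exists g : dual X, forall x, f (A x) = h (g x)) ->
  bounded_invertible A.
Proof.
move=> hN [hinv hK hinvK] [AD AZ] [Ainv [B [AK AinvK BP _ _]]] hA.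
have hinvN t : `|hinv t| = `|t| by rewrite -hN hinvK.
have AinvD : {morph Ainv : x y / x + y}.
  by move=> x y; apply: (can_inj AK); rewrite AD !AinvK.
have AinvZ t x : Ainv (t *: x) = hinv t *: Ainv x.
  by apply: (can_inj AK); rewrite AZ hinvK !AinvK.
exists Ainv; split=> //.
  apply: (semilinear_bounded archK nX hN AD AZ) => f.
  have [g gP] := hA f; have [M _ gM] := dual_le g; exists M => x.
  by rewrite gP hN.
apply: (semilinear_bounded archK nX hinvN AinvD AinvZ) => f.
have [M _ BM] := dual_le (B f); exists M => x.
by rewrite -hN -BP.
Qed.

Lemma induced_unique (K : numFieldType) (X : normedModType K)
    (T : ray X -> ray X) (S : ray (dual X) -> ray (dual X)) (P : (X -> X) -> Prop) :
  dim_ge X 3 ->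
  (forall A, P A -> exists h, [/\ bijective h, is_semilinear h A & induced_by T S h A]) ->
  forall A B, P A -> P B -> exists2 c : K, c != 0 & forall x, B x = c *: A x.
Proof.
move=> dimX PP A B /PP[h [[hi _ hiK] sA [Ai [_ [AK _ _ TA _]]]]].
move=> /PP[k [_ sB [_ [_ [_ _ _ TB _]]]]].
apply: (semilinear_unique dimX _ (can_inj AK) sA sB) => [a|x x0].
  by exists (hi a).
by rewrite -TA // TB.
Qed.

Unset Implicit Arguments.

Theorem corollary1 (R : realType) :
  (forall (X : completeNormedModType R)
          (T : ray X -> ray X) (S : ray (dual X) -> ray (dual X)),
     dim_ge X 3 -> bijective T -> bijective S -> preserves_orth T S ->
     exists_unique_up_to_scalar (fun A : X -> X =>
       [/\ is_semilinear id A, bounded_invertible A & induced_by T S id A]))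
  /\
  (forall (X : completeNormedModType R[i])
          (T : ray X -> ray X) (S : ray (dual X) -> ray (dual X)),
     dim_ge X 3 -> bijective T -> bijective S -> preserves_orth T S ->
     (~ finite_dim X ->
        exists_unique_up_to_scalar (fun A : X -> X =>
          bounded_invertible A /\
          ((is_semilinear id A /\ induced_by T S id A) \/
           (is_semilinear (@conjc R) A /\ induced_by T S (@conjc R) A))))
     /\
     (finite_dim X ->
        exists_unique_up_to_scalar (fun A : X -> X =>
          exists h : {rmorphism R[i] -> R[i]},
            [/\ bijective h, is_semilinear h A, bijective A
              & induced_by T S h A]))).
Proof.
split=> X T S dimX Tbij Sbij TS.
  have nX := @real_norming_dual R X.
  have [h [A [hbij Abij sA iA hA]]] := orth_preserving_semilinear
    (norming_dual_separating nX) dimX Tbij Sbij TS.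
  have hE : (h : R -> R) = id by apply/funext; exact: real_rmorph_id.
  split; last first.
    apply: (@induced_unique _ _ T S _ dimX) => B [sB _ iB].
    by exists id; split=> //; exists id.
  exists A; split; [by rewrite -hE| |by rewrite -hE].
  apply: (induced_bounded_invertible (@real_archimedean R) nX _ hbij sA iA hA).
  by move=> t; rewrite hE.
have nX := @complex_norming_dual R X.
have sepX := norming_dual_separating nX.
have [h [A [hbij Abij sA iA hA]]] := orth_preserving_semilinear
  sepX dimX Tbij Sbij TS.
split=> [infX|finX]; last first.
  split; first by exists A, h.
  by apply: (@induced_unique _ _ T S _ dimX) => B [k [kbij sB _ iB]]; exists k.
split; last first.
  apply: (@induced_unique _ _ T S _ dimX) => B [_ [[sB iB]|[sB iB]]]; last first.
    by exists (@conjc R); split=> //; exists (@conjc R); exact: conjcK.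
  by exists id; split=> //; exists id.
(* The adjoint [B f] is a bounded functional with [B f \o A = h \o f], as the gliding hump
   requires. *)
have h1 : forall t, `|t| < 1 -> `|h t| <= 1.
  apply: (rmorph_bounded_of_weakly_bounded
    (@complex_archimedean R) (A := A) sepX infX) => f.
  have [Ainv [B [AK _ BP _ _]]] := iA.
  by exists (B f) => x; rewrite BP AK.
exists A; split.
  apply: (induced_bounded_invertible (@complex_archimedean R) nX _ hbij sA iA hA).
  by move=> t; have [->|->] := complex_rmorph_id_or_conj h1; rewrite ?normcJ.
have [/funext hE|/funext hE] := complex_rmorph_id_or_conj h1; [left|right].
  by rewrite -hE.
by rewrite -hE.
Qed.
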